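(* Let $(L,\cdot)$ be a C-loop. If every element of $L$ is a square (i.e. every $y\in L$ equals $x^2$ for some $x\in L$), then $L$ is an Osborn loop; hence $L$ is a group.
   Context: A C-loop is a loop satisfying $x(y(yz))=((xy)y)z$ for all $x,y,z$. Maps are written on the right and composed from left to right; $yR_x=yx$, $yL_x=xy$. A loop $L$ is an Osborn loop if $x(yz\cdot x)=(x\cdot yE_x)\cdot zx$ for all $x,y,z\in L$, where $E_x=R_xL_xR_x^{-1}L_x^{-1}$ (equivalently, $(E_xL_x,\,R_x,\,R_xL_x)$ is an autotopism of $L$ for every $x\in L$, where a triple $(U,V,W)$ of permutations of $L$ is an autotopism if $xU\cdot yV=(x\cdot y)W$ for all $x,y\in L$). *)

(* Defs.v *)
From HB Require Import structures.
From mathcomp Require Import ssreflect ssrfun ssrbool eqtype ssrnat seq.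
From mathcomp Require Import choice fintype monoid.

Set Implicit Arguments.
Unset Strict Implicit.
Unset Printing Implicit Defensive.

Local Open Scope group_scope.

(* The divisions are uniquely determined by the multiplication: the four
   cancellation laws say that all left and right translations are bijective.
   The structure extends [baseUMagmaType] and not [umagmaType] because the
   latter requires a choice operator on the carrier. *)
HB.mixin Record BaseUMagma_isLoop L of BaseUMagma L := {
  loop_mul1l : left_id (@one L) (@mul L);
  loop_mulr1 : right_id (@one L) (@mul L);
  ldiv : L -> L -> L; (* [ldiv x y] is x \ y *)
  rdiv : L -> L -> L; (* [rdiv y x] is y / x *)
  loop_mulKl : forall x, cancel (fun y => x * y) (ldiv x);
  loop_ldivK : forall x, cancel (ldiv x) (fun y => x * y);
  loop_mulKr : forall x, cancel (fun y => y * x) (fun y => rdiv y x);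
  loop_rdivK : forall x, cancel (fun y => rdiv y x) (fun y => y * x)
}.

#[short(type="loopType")]
HB.structure Definition Loop := {L of BaseUMagma_isLoop L & BaseUMagma L}.

Bind Scope group_scope with Loop.sort.

Section Loops.
Variable L : loopType.
Implicit Types x y z : L.

Definition Ltrans x : L -> L := fun y => x * y.
Definition Rtrans x : L -> L := fun y => y * x.
Definition LtransV x : L -> L := fun y => ldiv x y.
Definition RtransV x : L -> L := fun y => rdiv y x.

(* Maps are written on the right and composed from left to right: [\;] is
   diagrammatic composition, and y E_x is [osbornE x y]. *)
Definition osbornE x : L -> L :=
  Rtrans x \; Ltrans x \; RtransV x \; LtransV x.

End Loops.

Definition is_C_loop (L : loopType) : Prop :=
  forall x y z : L, x * (y * (y * z)) = ((x * y) * y) * z.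

Definition is_Osborn_loop (L : loopType) : Prop :=
  forall x y z : L, x * ((y * z) * x) = (x * osbornE x y) * (z * x).

(* [groupType] would require a choice operator on the carrier. *)
Definition is_group (L : loopType) : Prop :=
  [/\ associative (@mul L), left_id (@one L) (@mul L),
      right_id (@one L) (@mul L)
    & exists inv : L -> L,
        left_inverse one inv (@mul L) /\ right_inverse one inv (@mul L)].

(* Main.v *)
Require Import Defs.
From mathcomp Require Import ssreflect ssrfun ssrbool eqtype ssrnat seq.
From mathcomp Require Import choice fintype monoid.

(** Setting the outer variables of the C-law to the identity gives both
    alternative laws, [y (y z) = (y y) z] and [x (y y) = (x y) y].  Feeding
    them back into the C-law turns it into [x (y^2 z) = (x y^2) z]: every
    square lies in the middle nucleus.  When every element is a square, this
    is associativity; the loop is then a group, where [osbornE x] is the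
    identity map and the Osborn law reduces to associativity. *)

Local Open Scope group_scope.

Lemma C_loop_left_alternative (L : loopType) (HC : is_C_loop L) (y z : L) :
  y * (y * z) = (y * y) * z.
Proof. by have := HC 1 y z; rewrite !loop_mul1l. Qed.

Lemma C_loop_right_alternative (L : loopType) (HC : is_C_loop L) (x y : L) :
  x * (y * y) = (x * y) * y.
Proof. by have := HC x y 1; rewrite !loop_mulr1. Qed.

(** With the two alternative laws, this is a regrouping of the C-law. *)
Lemma C_loop_square_middle_nucleus (L : loopType) (HC : is_C_loop L)
    (x y z : L) : x * ((y * y) * z) = (x * (y * y)) * z.
Proof.
by rewrite -C_loop_left_alternative // C_loop_right_alternative // HC.
Qed.

Lemma assoc_loop_is_group (L : loopType) (mulA : associative (@mul L)) :
  is_group L.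
Proof.
split=> //; [exact: loop_mul1l | exact: loop_mulr1 |].
exists (fun x => ldiv x 1); split=> x; last exact: loop_ldivK.
(* Left translation by x is injective, and it sends both sides to x. *)
apply: (can_inj (loop_mulKl x)) => /=.
by rewrite mulA loop_ldivK loop_mul1l loop_mulr1.
Qed.

Lemma assoc_loop_osbornE (L : loopType) (mulA : associative (@mul L))
    (x y : L) : osbornE x y = y.
Proof.
rewrite /osbornE /= /Rtrans /Ltrans /RtransV /LtransV mulA.
by rewrite (loop_mulKr x (x * y)) (loop_mulKl x y).
Qed.

Lemma assoc_loop_is_Osborn (L : loopType) (mulA : associative (@mul L)) :
  is_Osborn_loop L.
Proof. by move=> x y z; rewrite assoc_loop_osbornE // !mulA. Qed.

Theorem corollary6p5 (L : loopType) (HC : is_C_loop L)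
    (Hsq : forall y : L, exists x : L, y = x ^+ 2) :
  is_Osborn_loop L /\ is_group L.
Proof.
have mulA : associative (@mul L).
  by move=> x y z; have [w ->] := Hsq y; apply: C_loop_square_middle_nucleus.
by split; [apply: assoc_loop_is_Osborn | apply: assoc_loop_is_group].
Qed.
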